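(* Let $\Lambda$ be a countably infinite set and let $\Gamma$ be a subshift of $\Lambda^\omega$. If $\Gamma$ is a subshift of finite type, then there exists $x\in\Gamma$ with $\omega(x)=\Gamma$.
   Context: Let $\omega=\{0,1,2,\dots\}$. $\Lambda^\omega$ is the set of infinite sequences $x=x_0x_1x_2\cdots$ over $\Lambda$, with the product topology where $\Lambda$ is discrete; the shift map is $\sigma(x_0x_1x_2\cdots)=x_1x_2\cdots$. A subshift of $\Lambda^\omega$ is a closed set $\Gamma\subseteq\Lambda^\omega$ with $\sigma(\Gamma)=\Gamma$. A word is a finite sequence over $\Lambda$ of length at least $1$; it is allowed for $\Gamma$ if it occurs as a block of consecutive symbols (subword) of some $x\in\Gamma$, and forbidden otherwise. A basis for the forbidden words of $\Gamma$ is a set $\mathcal F$ of forbidden words such that every forbidden word contains some element of $\mathcal F$ as a subword. $\Gamma$ is a subshift of finite type (SFT) if it has a finite basis for its forbidden words. For a point $x$, $\omega(x)=\bigcap_{N\in\omega}\overline{\{\sigma^i(x):i\ge N\}}$. *)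

(* Defs.v *)
From HB Require Import structures.
From mathcomp Require Import all_boot.
From mathcomp Require Import boolp classical_sets functions cardinality topology.

Set Implicit Arguments.
Unset Strict Implicit.
Unset Printing Implicit Defensive.

Local Open Scope classical_set_scope.

Notation full_shift L := {ptws nat -> discrete_topology L}.

Section Subshifts.
Variable L : choiceType.
Implicit Types (x : full_shift L) (G : set (full_shift L)) (w u : seq L)
  (F : set (seq L)).

Definition shift x : full_shift L := fun n => x n.+1.

Definition subshift G := closed G /\ shift @` G = G.

Definition word w := (0 < size w)%N.

Definition occurs_in w x :=
  exists i, w = mkseq (fun k => x (i + k)%N : L) (size w).

Definition allowed G w := word w /\ exists2 x, G x & occurs_in w x.

Definition forbidden G w := word w /\ ~ allowed G w.

Definition forbidden_basis G F :=
  F `<=` forbidden G /\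
  forall w, forbidden G w -> exists2 u, F u & infix u w.

Definition finite_type G := exists2 F, finite_set F & forbidden_basis G F.

Definition omega_limit x : set (full_shift L) :=
  \bigcap_N closure [set iter i shift x | i in [set i | (N <= i)%N]].

End Subshifts.

(* Main.v *)
Require Import Defs.
From HB Require Import structures.
From mathcomp Require Import all_boot.
From mathcomp Require Import boolp classical_sets functions cardinality topology.

Local Open Scope classical_set_scope.
Local Open Scope card_scope.

(** A finite basis [F] of forbidden words mentions only finitely many letters,
    so some letter [a] occurs in no word of [F].  Hence [s a t] avoids [F] as
    soon as [s] and [t] do.  Enumerate the words [w_0, w_1, ...] avoiding [F]
    and let [x = a w_0 a w_1 a w_2 ...].  Every prefix of [x] avoids [F], so
    [x] lies in the closed set [G].  Each word [v] allowed for [G] recurs in [x]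
    arbitrarily far out, because all the words [a^N v] are among the [w_k]. *)

(** An occurrence of [u] that neither ends within [s] nor starts after the middle [a] covers that
    [a], which would put [a] in [u]. *)
Lemma infix_cat_cons (T : eqType) (u s t : seq T) (a : T) :
  a \notin u -> infix u (s ++ a :: t) -> infix u s || infix u t.
Proof.
move=> au /infixP[p [q e]].
have [le_pu_s|lt_s_pu] := leqP (size (p ++ u)) (size s).
  apply/orP; left; apply/infixP.
  exists p, (drop (size (p ++ u)) s).
  rewrite -[LHS](cat_take_drop (size (p ++ u))) catA; congr (_ ++ _).
  have /(congr1 (take (size (p ++ u)))) := e.
  by rewrite takel_cat // catA take_size_cat.
have [lt_s_p|le_p_s] := ltnP (size s) (size p).
  apply/orP; right; apply/infixP.
  exists (drop (size s).+1 p), q.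
  have /(congr1 (drop (size s).+1)) := e.
  rewrite -cat_rcons drop_size_cat ?size_rcons // drop_cat => ->.
  (* Boundary case: [u] starts right after the middle [a]. *)
  case: ltnP => // le_p_s; have /eqP eq_p : size p == (size s).+1.
    by rewrite eqn_leq le_p_s.
  by rewrite -eq_p subnn drop0 drop_size.
case/negP: au.
have /(congr1 (nth a ^~ (size s))) := e.
rewrite nth_cat ltnn subnn /= nth_cat ltnNge le_p_s /= nth_cat.
rewrite size_cat in lt_s_pu.
have lt_u : size s - size p < size u by rewrite ltn_subLR.
by rewrite lt_u => ->; exact: mem_nth.
Qed.

Lemma exists_notin_seqs (L : choiceType) (F : set (seq L)) :
  infinite_set [set: L] -> finite_set F ->
  exists a : L, forall u, F u -> a \notin u.
Proof.
move=> Linf /finite_seqP[s ->]; apply: contrapT => noa.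
apply: Linf; apply/finite_seqP; exists (flatten s).
apply/seteqP; split=> // a _ /=; apply: contrapT => /negP as_.
apply: noa; exists a => u /= us; apply: contra as_ => au.
by apply/flattenP; exists u.
Qed.

Lemma countable_seq_enum (L : choiceType) : [set: L] #= [set: nat] ->
  exists e : nat -> seq L, forall w, exists n, e n = w.
Proof.
case/card_set_bijP=> f; rewrite setTT_bijective => -[g fK _].
(* Words over [nat] are coded by numbers, then carried to [L] letterwise; numbers that code no word
   give [[::]]. *)
exists (fun n => map g (odflt [::] (unpickle n))) => w.
by exists (pickle (map f w)); rewrite pickleK /= mapK.
Qed.

Section Shift.
Variable L : choiceType.
Implicit Types (x y : full_shift L) (G : set (full_shift L)).

(** The supersets of the cylinders around [y] form a filter. It converges to [y] because it does so
    in each coordinate: the cylinder of length [i.+1] fixes coordinate [i]. *)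
Lemma nbhs_full_shift y (B : set (full_shift L)) : nbhs y B ->
  exists n, forall z : full_shift L, (forall k, k < n -> z k = y k) -> B z.
Proof.
pose cyl n : set (full_shift L) := [set z | forall k, k < n -> z k = y k].
pose F : set_system (full_shift L) := [set A | exists n, cyl n `<=` A].
suff FF : Filter F.
  suff /(_ B) Fy : F --> y by move=> /Fy [n]; exists n.
  apply/cvg_sup => i A /= [_ [[C oC <-] Cy] sub].
  exists i.+1 => z zy; apply: sub => /=.
  by rewrite zy.
split.
- by exists 0.
- move=> A A' [n nA] [m mA']; exists (maxn n m) => z zy; split.
    by apply: nA => k kn; apply: zy; rewrite leq_max kn.
  by apply: mA' => k km; apply: zy; rewrite leq_max km orbT.
- by move=> A A' AA' [n nA]; exists n => z /nA /AA'.
Qed.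

Lemma iter_shiftE i x k : iter i (@shift L) x k = x (i + k).
Proof. by elim: i k => //= i IH k; rewrite /shift IH addnS. Qed.

Lemma subshift_iter G i x : subshift G -> G x -> G (iter i (@shift L) x).
Proof.
by move=> [_ GG] Gx; elim: i => //= i IH; rewrite -GG; exists (iter i (@shift L) x).
Qed.

Lemma omega_limit_sub {G x} : subshift G -> G x -> omega_limit x `<=` G.
Proof.
(* The term [N = 0] of the intersection, the closure of the whole orbit, already lies in [G]. *)
move=> Gs Gx y /(_ 0 I) yx; apply: Gs.1; apply: closureS yx.
by move=> _ [i _ <-]; exact: subshift_iter.
Qed.

Definition avoids (F : set (seq L)) (s : seq L) :=
  forall u, F u -> ~~ infix u s.

Lemma avoids_infix F s t : infix s t -> avoids F t -> avoids F s.
Proof.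
by move=> st tF u Fu; apply: contra (tF u Fu) => us; exact: infix_trans st.
Qed.

Lemma avoids_cat_cons F a s t : (forall u, F u -> a \notin u) ->
  avoids F s -> avoids F t -> avoids F (s ++ a :: t).
Proof.
move=> aF sF tF u Fu; apply/negP => /(infix_cat_cons _ _ _ _ _ (aF u Fu)).
by rewrite (negPf (sF u Fu)) (negPf (tF u Fu)).
Qed.

Section Basis.
Variables (G : set (full_shift L)) (F : set (seq L)).
Hypotheses (G_subshift : subshift G) (F_basis : forbidden_basis G F).

Lemma avoids_nil : avoids F [::].
Proof.
by move=> u /F_basis.1[]; case: u.
Qed.

Lemma avoids_prefix x n : G x -> avoids F (mkseq x n).
Proof.
move=> Gx u Fu; apply/negP => /infixP[p [q e]].
have [wu] := F_basis.1 _ Fu; apply; split => //; exists x => //.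
exists (size p).
have sz : n = size p + (size u + size q) by rewrite -!size_cat -e size_mkseq.
apply: (@eq_from_nth _ (x 0)) => [|i iu]; first by rewrite size_mkseq.
rewrite nth_mkseq //.
have /(congr1 (nth (x 0) ^~ (size p + i))) := e.
rewrite nth_cat ltnNge leq_addr /= addKn nth_cat iu nth_mkseq //.
by rewrite sz ltn_add2l ltn_addr.
Qed.

(** Each prefix of [x] is allowed, hence occurs in some point of [G]; shifting that point to the
    occurrence gives points of [G] arbitrarily close to [x], and [G] is closed. *)
Lemma avoids_mem x : (forall n, avoids F (mkseq x n)) -> G x.
Proof.
move=> xF; apply: G_subshift.1 => B /nbhs_full_shift[n nB].
(* Length [n.+1] rather than [n], since a word must be nonempty. *)
have [_ [z Gz [i e]]] : allowed G (mkseq x n.+1).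
  apply: contrapT => nall.
  have [] := F_basis.2 (mkseq x n.+1); first by split=> //; rewrite /word size_mkseq.
  by move=> u Fu; exact/negP/xF.
exists (iter i (@shift L) z); split; first exact: subshift_iter.
apply: nB => k kn; rewrite iter_shiftE.
have /(congr1 (nth (x 0) ^~ k)) := e.
by rewrite size_mkseq !nth_mkseq // ltnW.
Qed.

End Basis.
End Shift.

Section Concatenation.
Variables (L : eqType) (a : L) (w : nat -> seq L).

Fixpoint joined n := if n is m.+1 then joined m ++ a :: w m else [::].

(** Every block contributes at least its [a], so stage [n.+1] is long enough and the default of
    [nth] is never reached. *)
Definition joined_limit n := nth a (joined n.+1) n.

Lemma size_joined n : n <= size (joined n).
Proof.
by elim: n => //= n IH; rewrite size_cat addnS ltnS; exact: leq_trans IH (leq_addr _ _).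
Qed.

Lemma prefix_joined m n : m <= n -> prefix (joined m) (joined n).
Proof.
move=> /subnKC <-; elim: (n - m) => [|k IH]; first by rewrite addn0 prefix_refl.
by rewrite addnS /=; apply: prefix_trans IH _; exact: prefix_prefix.
Qed.

Lemma nth_joined n i : i < size (joined n) -> nth a (joined n) i = joined_limit i.
Proof.
move=> i_n; have [le|lt] := leqP n i.+1.
  by have /prefixP[t] := prefix_joined _ _ le; rewrite /joined_limit => ->;
    rewrite nth_cat i_n.
have /prefixP[t ->] := prefix_joined _ _ (ltnW lt).
by rewrite nth_cat size_joined.
Qed.

Lemma mkseq_joined_limit n : mkseq joined_limit n = take n (joined n).
Proof.
have szn : size (take n (joined n)) = n by rewrite size_takel // size_joined.
apply: (@eq_from_nth _ a); rewrite size_mkseq // => i i_n.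
rewrite nth_mkseq // nth_take // nth_joined //.
exact: leq_trans (size_joined n).
Qed.

(** The offset [k.+1] skips the separator [a] in front of [w n]. *)
Lemma joined_limit_word n k : k < size (w n) ->
  joined_limit (size (joined n) + k.+1) = nth a (w n) k.
Proof.
move=> kw; rewrite -(nth_joined n.+1) /=.
  by rewrite nth_cat ltnNge leq_addr /= addKn.
by rewrite size_cat ltn_add2l.
Qed.

End Concatenation.

Theorem corollary19 (L : choiceType) (L_countably_infinite : [set: L] #= [set: nat])
    (G : set (full_shift L)) (G_subshift : subshift G) (G_sft : finite_type G) :
  exists2 x : full_shift L, G x & omega_limit x = G.
Proof.
have [F finF basisF] := G_sft.
have [a aF] : exists a, forall u, F u -> a \notin u.
  apply: exists_notin_seqs finF.
  by rewrite (eq_finite_set L_countably_infinite); exact: infinite_nat.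
have [e e_surj] := countable_seq_enum _ L_countably_infinite.
have nilF : avoids L F [::] := avoids_nil _ _ _ basisF.
(* Entries of the enumeration that do not avoid [F] are replaced by the empty sequence. *)
pose w n := if `[< avoids L F (e n) >] then e n else [::].
have wF n : avoids L F (w n) by rewrite /w; case: asboolP.
pose x : full_shift L := joined_limit L a w.
have joinedF n : avoids L F (joined L a w n).
  by elim: n => //= n IH; exact: avoids_cat_cons.
have Gx : G x.
  apply: (avoids_mem _ _ _ G_subshift basisF) => n; rewrite mkseq_joined_limit.
  by apply: avoids_infix (joinedF n); exact: infix_take.
exists x => //; apply/seteqP; split; first exact: omega_limit_sub.
(* It remains to find [i >= N] such that the [i]-th shift of [x] agrees with [y] on the first [n]
   coordinates. *)
move=> y Gy N _ B /nbhs_full_shift[n nB].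
have aNF : avoids L F (nseq N a ++ mkseq y n).
  elim: N => [|N IH]; first exact: (avoids_prefix _ _ _ basisF).
  exact: (avoids_cat_cons _ _ _ [::]).
have [m em] := e_surj (nseq N a ++ mkseq y n).
have wm : w m = nseq N a ++ mkseq y n by rewrite /w em asboolT.
(* Start of the copy of the prefix of [y]: past the earlier blocks, one separator and [N] padding
   letters. The padding forces [i >= N] wherever the word is enumerated. *)
set i := size (joined L a w m) + N.+1.
exists (iter i (@shift L) x); split.
  by exists i => //=; rewrite /i addnS ltnW // ltnS leq_addl.
apply: nB => k kn; rewrite iter_shiftE /i -addnA addSn.
rewrite [LHS]joined_limit_word wm.
  by rewrite nth_cat size_nseq ltnNge leq_addr /= addKn nth_mkseq.
by rewrite size_cat size_nseq size_mkseq ltn_add2l.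
Qed.
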